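(* Let $n, m, k$ be positive integers, let $f : \mathbb{B}^n \to \mathbb{B}^m$ and $g : \mathbb{B}^m \to \mathbb{B}^k$ be Boolean functions, and let $\phi(x,y,z) = (x, y \oplus f(x), z)$ and $\gamma(x,y,z) = (x, y, z \oplus g(y))$ on $\mathbb{B}^{n+m+k}$. Let $G_{2s}$ be the subgroup of $G(\mathbb{B}^{n+m+k})$ generated by $\phi$ and $\gamma$. For $\psi \in G_{2s}$ let $U_\psi$ be the linear operator on $\otimes^{n+m+k}\mathbb{C}^2$ determined on the computational basis by $U_\psi |x\rangle|y\rangle|z\rangle = |x'\rangle|y'\rangle|z'\rangle$, where $(x',y',z') = \psi(x,y,z)$. Then the mapping $\psi \mapsto U_\psi$ is a unitary representation of the group $G_{2s}$ in the unitary group of the tensor-product space $\otimes^{n+m+k}\mathbb{C}^2$.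
   Context: $\mathbb{B} = \{0,1\}$, and $\oplus$ denotes (componentwise) Boolean exclusive-or. $G(\mathbb{B}^p)$ is the group, under functional composition, of invertible functions $\mathbb{B}^p \to \mathbb{B}^p$, with identity $e$. The group $G_{2s}$ is $\{e, \phi, \gamma, \phi \circ \gamma, (\phi \circ \gamma)^2, (\phi \circ \gamma)^3, \phi \circ (\gamma \circ \phi), \gamma \circ (\phi \circ \gamma)\}$. The space $\otimes^{n+m+k}\mathbb{C}^2$ carries its standard Hermitian inner product, for which the computational basis $\{|x\rangle|y\rangle|z\rangle : x \in \mathbb{B}^n, y \in \mathbb{B}^m, z \in \mathbb{B}^k\}$ is orthonormal. *)

(* Defs.v *)
From HB Require Import structures.
From mathcomp Require Import all_boot all_order all_fingroup all_algebra.
From mathcomp Require Import reals complex.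

Set Implicit Arguments.
Unset Strict Implicit.
Unset Printing Implicit Defensive.

Import GRing.Theory Num.Theory.

Declare Scope bits_scope.
Delimit Scope bits_scope with B.

(* Bit strings are row vectors so that concatenation is [row_mx] and the two
   parts of a string are [lsubmx] and [rsubmx]. *)
Definition bits (p : nat) : finType := 'rV[bool]_p.

Definition xorb_bits p (x y : bits p) : bits p := map2_mx addb x y.
Notation "x (+) y" := (xorb_bits x y) : bits_scope.

Definition cat_bits p q (x : bits p) (y : bits q) : bits (p + q) := row_mx x y.
Definition triple n m k (x : bits n) (y : bits m) (z : bits k)
  : bits (n + m + k) := cat_bits (cat_bits x y) z.
Definition xpart n m k (w : bits (n + m + k)) : bits n := lsubmx (lsubmx w).
Definition ypart n m k (w : bits (n + m + k)) : bits m := rsubmx (lsubmx w).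
Definition zpart n m k (w : bits (n + m + k)) : bits k := rsubmx w.

Section Triple.
Variables n m k : nat.

Lemma xpartK (x : bits n) (y : bits m) (z : bits k) : xpart (triple x y z) = x.
Proof. by rewrite /xpart /triple /cat_bits !row_mxKl. Qed.

Lemma ypartK (x : bits n) (y : bits m) (z : bits k) : ypart (triple x y z) = y.
Proof. by rewrite /ypart /triple /cat_bits row_mxKl row_mxKr. Qed.

Lemma zpartK (x : bits n) (y : bits m) (z : bits k) : zpart (triple x y z) = z.
Proof. by rewrite /zpart /triple /cat_bits row_mxKr. Qed.

Lemma tripleK (w : bits (n + m + k)) : triple (xpart w) (ypart w) (zpart w) = w.
Proof. by rewrite /triple /cat_bits !hsubmxK. Qed.

End Triple.

Lemma xorb_bitsK p (x y : bits p) : xorb_bits (xorb_bits y x) x = y.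
Proof. by apply/matrixP=> i j; rewrite !mxE addbK. Qed.

(* MathComp's product on {perm T} is (s * t) x = t (s x).  [invfun T] is a copy
   of {perm T} whose group law is functional composition,
   (s * t) x = s (t x); see [invfunM]. *)
Record invfun (T : finType) := InvFun { invfun_perm : {perm T} }.
HB.instance Definition _ (T : finType) := [isNew for @invfun_perm T].
HB.instance Definition _ (T : finType) := [Finite of invfun T by <:].

Definition invfun_fun (T : finType) (s : invfun T) : T -> T := invfun_perm s.
Coercion invfun_fun : invfun >-> Funclass.

Section InvFunGroup.
Variable T : finType.
Implicit Types s t u : invfun T.

Definition invfun_one : invfun T := InvFun 1%g.
Definition invfun_mul s t : invfun T :=
  InvFun (invfun_perm t * invfun_perm s)%g.
Definition invfun_inv s : invfun T := InvFun (invfun_perm s)^-1%g.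

Lemma invfun_mulA : associative invfun_mul.
Proof. by move=> s t u; rewrite /invfun_mul /= mulgA. Qed.
Lemma invfun_mul1 : left_id invfun_one invfun_mul.
Proof. by case=> s; rewrite /invfun_mul /= mulg1. Qed.
Lemma invfun_mulV : left_inverse invfun_one invfun_inv invfun_mul.
Proof. by case=> s; rewrite /invfun_mul /= mulgV. Qed.

HB.instance Definition _ := Finite_isGroup.Build (invfun T)
  invfun_mulA invfun_mul1 invfun_mulV.

Lemma invfunM s t x : (s * t)%g x = s (t x).
Proof. by rewrite /invfun_fun /= permM. Qed.

Lemma invfun1 x : (1%g : invfun T) x = x.
Proof. by rewrite /invfun_fun /= perm1. Qed.

End InvFunGroup.

Section Generators.
Variables n m k : nat.
Variables (f : bits n -> bits m) (g : bits m -> bits k).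

Definition phi_fun (w : bits (n + m + k)) : bits (n + m + k) :=
  let: (x, y, z) := (xpart w, ypart w, zpart w) in triple x (y (+) f x)%B z.
Definition gamma_fun (w : bits (n + m + k)) : bits (n + m + k) :=
  let: (x, y, z) := (xpart w, ypart w, zpart w) in triple x y (z (+) g y)%B.

Lemma phi_funK : involutive phi_fun.
Proof.
by move=> w; rewrite /phi_fun xpartK ypartK zpartK xorb_bitsK tripleK.
Qed.

Lemma gamma_funK : involutive gamma_fun.
Proof.
by move=> w; rewrite /gamma_fun xpartK ypartK zpartK xorb_bitsK tripleK.
Qed.

Definition phi : invfun (bits (n + m + k)) := InvFun (perm (inv_inj phi_funK)).
Definition gamma : invfun (bits (n + m + k)) :=
  InvFun (perm (inv_inj gamma_funK)).

Definition G2s : {group invfun (bits (n + m + k))} := <<[set phi; gamma]>>%G.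

Lemma phiE x y z : phi (triple x y z) = triple x (y (+) f x)%B z.
Proof. by rewrite /invfun_fun permE /phi_fun xpartK ypartK zpartK. Qed.

Lemma gammaE x y z : gamma (triple x y z) = triple x y (z (+) g y)%B.
Proof. by rewrite /invfun_fun permE /gamma_fun xpartK ypartK zpartK. Qed.

End Generators.

Local Open Scope ring_scope.

(* The p-fold tensor power of C^2, with C^2 the functions from bool to C: a
   tensor is its array of 2^p coordinates. *)
Definition qubits (C : numClosedFieldType) (p : nat) : vectType C :=
  {ffun bits p -> C^o}.

Section Qubits.
Variable C : numClosedFieldType.

Definition qubit_ket (b : bool) : {ffun bool -> C} := [ffun a => (a == b)%:R].

Definition pure_tensor p (v : 'I_p -> {ffun bool -> C}) : qubits C p :=
  [ffun w : bits p => \prod_(i < p) v i (w ord0 i)].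

Definition ket p (w : bits p) : qubits C p :=
  pure_tensor (fun i => qubit_ket (w ord0 i)).

Definition tensor p q (u : qubits C p) (v : qubits C q) : qubits C (p + q) :=
  [ffun w : bits (p + q) => u (lsubmx w) * v (rsubmx w)].

(* Conjugate-linear in the first argument. *)
Definition inner p (u v : qubits C p) : C := \sum_(w : bits p) (u w)^* * v w.

Definition unitary p (U : 'End(qubits C p)) : Prop :=
  bijective U /\ forall u v, inner (U u) (U v) = inner u v.

Definition unitary_representation (gT : finGroupType) (G : {group gT}) p
    (rho : gT -> 'End(qubits C p)) : Prop :=
  [/\ forall s, s \in G -> unitary (rho s),
      rho 1%g = \1%VF
    & {in G &, forall s t, rho (s * t)%g = (rho s \o rho t)%VF}].

(* Linear extension of |w> |-> |s w>; see [U_opE] and [U_op_unique]. *)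
Definition U_fun p (s : invfun (bits p)) (v : qubits C p) : qubits C p :=
  \sum_(w : bits p) v w *: ket (s w).
Definition U_op p (s : invfun (bits p)) : 'End(qubits C p) :=
  linfun (U_fun s).

Lemma ketE p (w a : bits p) : ket w a = (a == w)%:R.
Proof.
rewrite ffunE; have [->|/eqP ne] := eqVneq a w.
  by rewrite big1 // => i _; rewrite ffunE eqxx.
have [i ne_i]: exists i, a ord0 i != w ord0 i.
  apply/existsP; apply: contraT => /existsPn eq_aw; case: ne.
  by apply/rowP=> i; apply/eqP; move: (eq_aw i); rewrite negbK.
by rewrite (bigD1 i) //= ffunE (negPf ne_i) mul0r.
Qed.

Lemma ket_cat p q (x : bits p) (y : bits q) :
  ket (cat_bits x y) = tensor (ket x) (ket y).
Proof.
apply/ffunP=> w; rewrite [RHS]ffunE !ketE -natrM mulnb; congr (_%:R).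
rewrite -{1}[w]hsubmxK; congr nat_of_bool.
by apply/eqP/andP=> [/eq_row_mx[-> ->]|[/eqP-> /eqP->]].
Qed.

Lemma inner_ket p (w a : bits p) : inner (ket w) (ket a) = (w == a)%:R.
Proof.
rewrite /inner (bigD1 w) //= !ketE eqxx conjC1 mul1r big1 ?addr0 // => b ne.
by rewrite !ketE (negPf ne) conjC0 mul0r.
Qed.

Lemma ket_expand p (v : qubits C p) : v = \sum_(w : bits p) v w *: ket w.
Proof.
apply/ffunP=> a; rewrite sum_ffunE (bigD1 a) //= ffunE ketE eqxx.
rewrite big1 ?addr0; first by rewrite [_ *: _]mulr1.
by move=> b; rewrite eq_sym ffunE ketE => /negPf->; rewrite scaler0.
Qed.

Lemma U_fun_linear p (s : invfun (bits p)) : linear (U_fun s).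
Proof.
move=> a u v; rewrite /U_fun scaler_sumr -big_split; apply: eq_bigr => w _.
by rewrite !ffunE scalerDl scalerA.
Qed.

HB.instance Definition _ p (s : invfun (bits p)) :=
  GRing.isLinear.Build C (qubits C p) (qubits C p) _ (U_fun s) (U_fun_linear s).

Lemma U_op_ket p (s : invfun (bits p)) (w : bits p) : U_op s (ket w) = ket (s w).
Proof.
rewrite lfunE /= /U_fun (bigD1 w) //= ketE eqxx scale1r big1 ?addr0 //.
by move=> a; rewrite ketE => /negPf->; rewrite scale0r.
Qed.

Lemma U_opE n m k (s : invfun (bits (n + m + k))) x y z x' y' z' :
  s (triple x y z) = triple x' y' z' ->
  U_op s (tensor (tensor (ket x) (ket y)) (ket z)) =
    tensor (tensor (ket x') (ket y')) (ket z').
Proof. by rewrite -!ket_cat U_op_ket => ->. Qed.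

Lemma U_op_unique n m k (s : invfun (bits (n + m + k)))
    (V : 'End(qubits C (n + m + k))) :
  (forall x y z x' y' z', s (triple x y z) = triple x' y' z' ->
    V (tensor (tensor (ket x) (ket y)) (ket z)) =
      tensor (tensor (ket x') (ket y')) (ket z')) ->
  V = U_op s.
Proof.
move=> VE; apply/lfunP=> v; rewrite [v]ket_expand !linear_sum /=.
apply: eq_bigr => w _; rewrite !linearZ /=; congr (_ *: _); rewrite U_op_ket.
have := VE _ _ _ _ _ _ (etrans (congr1 s (tripleK w)) (esym (tripleK (s w)))).
by rewrite -!ket_cat -/(triple _ _ _) -/(triple _ _ _) !tripleK.
Qed.

End Qubits.

(* Main.v *)
Require Import Defs.
From mathcomp Require Import all_boot all_order all_fingroup all_algebra.
From mathcomp Require Import reals complex.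

(* Since a permutation operator carries coordinates along, (U_s v)(s w) = v(w),
   it preserves inner products by reindexing the sum over the basis.
   Multiplicativity is checked on the basis. *)

Import GRing.Theory.
Local Open Scope ring_scope.

(** Every invertible [s] permutes the orthonormal basis of kets, so [U_op s] is unitary
    ([U_op_unitary]), and [U_op] respects unit and product on kets, hence everywhere ([U_op1],
    [U_opM]). The representation of [G2s] is the restriction of this one. *)

Lemma lfun_ket_ext (C : numClosedFieldType) p (U V : 'End(qubits C p)) :
  (forall w : bits p, U (ket C w) = V (ket C w)) -> U = V.
Proof.
move=> eqUV; apply/lfunP=> v; rewrite [v]ket_expand !linear_sum /=.
by apply: eq_bigr => w _; rewrite !linearZ /= eqUV.
Qed.

Lemma U_op1 (C : numClosedFieldType) p :
  U_op C (1%g : invfun (bits p)) = \1%VF.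
Proof.
by apply: lfun_ket_ext => w; rewrite U_op_ket invfun1 id_lfunE.
Qed.

(** The order of factors is kept because the product of [invfun] is functional composition. *)
Lemma U_opM (C : numClosedFieldType) p (s t : invfun (bits p)) :
  U_op C (s * t)%g = (U_op C s \o U_op C t)%VF.
Proof.
by apply: lfun_ket_ext => w; rewrite comp_lfunE !U_op_ket invfunM.
Qed.

Lemma invfun_inj (T : finType) (s : invfun T) : injective s.
Proof. exact: perm_inj. Qed.

(** By injectivity of [s], only the term of [w] reaches coordinate [s w]. Evaluating at [s w] avoids
    [s^-1] and suits reindexing by [s]. *)
Lemma U_op_coord (C : numClosedFieldType) p (s : invfun (bits p))
    (v : qubits C p) (w : bits p) : U_op C s v (s w) = v w.
Proof.
rewrite lfunE /= /U_fun sum_ffunE (bigD1 w) //= ffunE ketE eqxx.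
rewrite big1 ?addr0; first by rewrite [_ *: _]mulr1.
move=> a; rewrite ffunE ketE (inj_eq (@invfun_inj _ s)) eq_sym => /negPf->.
by rewrite scaler0.
Qed.

Lemma U_op_unitary (C : numClosedFieldType) p (s : invfun (bits p)) :
  unitary (U_op C s).
Proof.
split=> [|u v].
  (* Both inverse laws come from multiplicativity and [U_op1]. *)
  exists (U_op C s^-1%g) => v;
    by rewrite -comp_lfunE -U_opM ?mulVg ?mulgV U_op1 id_lfunE.
rewrite /inner (reindex_inj (@invfun_inj _ s)) /=.
by apply: eq_bigr => w _; rewrite !U_op_coord.
Qed.

Theorem proposition2 (R : realType) (n m k : nat)
    (n_gt0 : (0 < n)%N) (m_gt0 : (0 < m)%N) (k_gt0 : (0 < k)%N)
    (f : bits n -> bits m) (g : bits m -> bits k) :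
  unitary_representation (G2s f g)
    (fun psi : invfun (bits (n + m + k)) => U_op R[i] psi).
Proof.
split=> [s _||s t _ _]; [exact: U_op_unitary | exact: U_op1 | exact: U_opM].
Qed.
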